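(* Let $p>1$. Let $g:\mathbb{R}^n\to\mathbb{R}\cup\{+\infty\}$ be proper, lower semicontinuous, and high-order prox-bounded of order $p$ with threshold $\gamma^{g,p}>0$. Let $f:\mathbb{R}^n\to\mathbb{R}$ be Fréchet differentiable, let $\varphi:=f+g$, let $\overline{x}\in\mathbb{R}^n$ with $\varphi(\overline{x})<+\infty$, and suppose that $f\in\mathcal{C}^2(U)$ for some open neighborhood $U$ of $\overline{x}$. Then, for each $\gamma\in(0,\gamma^{g,p})$ and each $\overline{y}\in\mathbf{T}_{\gamma\varphi}^{p}(\overline{x})$, $$\widehat{\partial}\varphi_\gamma^p(\overline{x})-\nabla^2f(\overline{x})(\overline{y}-\overline{x})\subseteq\big(\nabla f(\overline{x})+\partial g(\overline{y})\big)\cap\left\{\frac{1}{\gamma}\|\overline{x}-\overline{y}\|^{p-2}(\overline{x}-\overline{y})\right\}.$$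
   Context: $\|\cdot\|$ and $\langle\cdot,\cdot\rangle$ are the Euclidean norm and inner product on $\mathbb{R}^n$. The expression $\|z\|^{p-2}z$ is understood as $0$ when $z=0$. A function $h:\mathbb{R}^n\to\mathbb{R}\cup\{+\infty\}$ is proper if it is finite at some point. $\mathcal{C}^2(U)$ denotes the functions that are twice continuously differentiable on $U$. For a set $A\subseteq\mathbb{R}^n$ and a vector $v$, $A\pm v:=\{a\pm v\mid a\in A\}$. A proper function $g$ is high-order prox-bounded of order $p>1$ if there exist $\gamma>0$ and $x\in\mathbb{R}^n$ with $\inf_{y\in\mathbb{R}^n}\{g(y)+\frac{1}{p\gamma}\|x-y\|^p\}>-\infty$; the supremum of all such $\gamma$ is the threshold $\gamma^{g,p}\in(0,+\infty]$. For $\gamma>0$, the high-order forward-backward envelope and splitting mapping of $\varphi=f+g$ are, respectively, the infimum $\varphi_\gamma^p(x)$ and the set of minimizers $\mathbf{T}_{\gamma\varphi}^{p}(x)$ over $y\in\mathbb{R}^n$ of $$y\mapsto f(x)+\langle\nabla f(x),y-x\rangle+g(y)+\frac{1}{p\gamma}\|x-y\|^p.$$ For $\psi:\mathbb{R}^n\to\mathbb{R}\cup\{+\infty\}$ and $\overline{x}$ with $\psi(\overline{x})$ finite, the Fréchet (regular) subdifferential is $$\widehat{\partial}\psi(\overline{x}):=\left\{\zeta\in\mathbb{R}^n\;\middle|\;\liminf_{x\to\overline{x}}\frac{\psi(x)-\psi(\overline{x})-\langle\zeta,x-\overline{x}\rangle}{\|x-\overline{x}\|}\ge 0\right\},$$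 and the Mordukhovich (limiting) subdifferential $\partial\psi(\overline{x})$ is the set of $\zeta\in\mathbb{R}^n$ for which there exist $x^k\to\overline{x}$ and $\zeta^k\in\widehat{\partial}\psi(x^k)$ with $\psi(x^k)\to\psi(\overline{x})$ and $\zeta^k\to\zeta$. *)

(* Defs.v *)
From HB Require Import structures.
From mathcomp Require Import all_boot all_order all_algebra.
From mathcomp Require Import all_classical all_reals all_analysis.

Set Implicit Arguments.
Unset Strict Implicit.
Unset Printing Implicit Defensive.

Import Order.TTheory GRing.Theory Num.Theory.
Import numFieldNormedType.Exports.

Local Open Scope classical_set_scope.
Local Open Scope ring_scope.

Section Euclidean.
Variables (R : realType) (n : nat).
Implicit Types (x y u v : 'rV[R]_n).

(* R^n is the space ['rV[R]_n] of row vectors.  The library's norm on it is the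
   sup norm, hence the explicit Euclidean norm.  Convergence and
   differentiability are taken in the library's topology, which is the one
   induced by either norm. *)
Definition edot u v : R := \sum_(i < n) u 0 i * v 0 i.

Definition enorm u : R := Num.sqrt (edot u u).

Definition grad (f : 'rV[R]_n -> R) x : 'rV[R]_n :=
  \row_(i < n) 'D_(delta_mx 0 i) f x.

(* The library's Jacobian acts on row vectors from the right: the product of
   the Hessian at [x] with [v] is [v *m hess f x], which is ['d (grad f) x v]
   when [grad f] is differentiable at [x]. *)
Definition hess (f : 'rV[R]_n -> R) x : 'M[R]_n := 'J (grad f) x.

Definition C2_on (U : set 'rV[R]_n) (f : 'rV[R]_n -> R) : Prop :=
  forall x, U x ->
    [/\ differentiable f x, differentiable (grad f) x
      & {for x, continuous (hess f)}].

End Euclidean.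

Section Subdifferentials.
Variables (R : realType) (n : nat).
Implicit Types (psi : 'rV[R]_n -> \bar R) (x zeta : 'rV[R]_n).

Definition frechet_subdiff psi xbar : set 'rV[R]_n :=
  [set zeta | psi xbar \is a fin_num /\
    (0 <= limf_einf
       (fun x => (psi x - psi xbar - (edot zeta (x - xbar))%:E)
                 * ((enorm (x - xbar))^-1)%:E) xbar^')%E].

Definition limiting_subdiff psi xbar : set 'rV[R]_n :=
  [set zeta | psi xbar \is a fin_num /\
    exists (xk zetak : nat -> 'rV[R]_n),
      [/\ xk k @[k --> \oo] --> xbar,
          forall k, frechet_subdiff psi (xk k) (zetak k),
          psi (xk k) @[k --> \oo] --> psi xbar
        & zetak k @[k --> \oo] --> zeta]].

End Subdifferentials.

Section HighOrder.
Variables (R : realType) (n : nat) (p : R).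
Implicit Types (f : 'rV[R]_n -> R) (g : 'rV[R]_n -> \bar R) (gamma : R).
Implicit Types (x y : 'rV[R]_n).

Definition proper_fun g : Prop := exists x, g x \is a fin_num.

Definition ho_prox_term gamma x y : R :=
  (p * gamma)^-1 * enorm (x - y) `^ p.

Definition ho_prox_params g : set R :=
  [set gamma | 0 < gamma /\ exists x,
     (-oo < ereal_inf [set g y + (ho_prox_term gamma x y)%:E | y in setT])%E].

Definition ho_prox_bounded g : Prop := exists gamma, ho_prox_params g gamma.

Definition ho_prox_threshold g : \bar R :=
  ereal_sup [set gamma%:E | gamma in ho_prox_params g].

Definition hofb_objective gamma f g x y : \bar R :=
  ((f x + edot (grad f x) (y - x))%:E + g y + (ho_prox_term gamma x y)%:E)%E.

Definition hofb_envelope gamma f g x : \bar R :=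
  ereal_inf [set hofb_objective gamma f g x y | y in setT].

Definition hofb_splitting gamma f g x : set 'rV[R]_n :=
  [set y | forall z,
     (hofb_objective gamma f g x y <= hofb_objective gamma f g x z)%E].

End HighOrder.

(* Main.v *)
(* As [ybar] minimizes the objective at [xbar], the map [x |-> objective x ybar]
   majorizes the envelope and touches it at [xbar], so a Frechet subgradient of
   the envelope there must be the gradient of this majorant, namely
   [hess f xbar (ybar - xbar) + w] with
   [w = gamma^-1 |xbar - ybar|^(p-2) (xbar - ybar)].  Fermat's rule for
   [y |-> objective xbar y] at [ybar] puts [w - grad f xbar] in the Frechet
   subdifferential of [g].  Differentiating [x |-> <grad f x, ybar - x>] yields
   the transpose of the Hessian, so its symmetry is needed; it is obtained from
   second differences and the mean value theorem. *)
Require Import Defs.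
From HB Require Import structures.
From mathcomp Require Import all_boot all_order all_algebra.
From mathcomp Require Import all_classical all_reals all_analysis.
From mathcomp Require Import ring lra.

Set Implicit Arguments.
Unset Strict Implicit.
Unset Printing Implicit Defensive.

Import Order.TTheory GRing.Theory Num.Theory.
Import numFieldNormedType.Exports.

Local Open Scope classical_set_scope.
Local Open Scope ring_scope.

(** * Euclidean inner product and norm, compared with the sup norm *)

Section EuclideanFacts.
Context {R : realType} {n : nat}.
Implicit Types (u v w : 'rV[R]_n) (a : R).

Lemma edot0r u : edot u 0 = 0.
Proof. by rewrite /edot big1// => i _; rewrite mxE mulr0. Qed.

Lemma edotC u v : edot u v = edot v u.
Proof. by apply: eq_bigr => i _; rewrite mulrC. Qed.

Lemma edotDr u v w : edot u (v + w) = edot u v + edot u w.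
Proof. by rewrite -big_split; apply: eq_bigr => i _; rewrite mxE mulrDr. Qed.

Lemma edotZr a u v : edot u (a *: v) = a * edot u v.
Proof. by rewrite mulr_sumr; apply: eq_bigr => i _; rewrite mxE mulrCA. Qed.

Lemma edotNr u v : edot u (- v) = - edot u v.
Proof. by rewrite -scaleN1r edotZr mulN1r. Qed.

Lemma edotBr u v w : edot u (v - w) = edot u v - edot u w.
Proof. by rewrite edotDr edotNr. Qed.

Lemma edotDl u v w : edot (u + v) w = edot u w + edot v w.
Proof. by rewrite edotC edotDr !(edotC w). Qed.

Lemma edotZl a u v : edot (a *: u) v = a * edot u v.
Proof. by rewrite edotC edotZr edotC. Qed.

Lemma edotNl u v : edot (- u) v = - edot u v.
Proof. by rewrite edotC edotNr edotC. Qed.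

Lemma edotBl u v w : edot (u - v) w = edot u w - edot v w.
Proof. by rewrite edotDl edotNl. Qed.

Lemma edot_mulmx u v (A : 'M[R]_n) : edot (u *m A) v = edot u (v *m A^T).
Proof.
rewrite /edot; under eq_bigr do rewrite mxE mulr_suml.
rewrite exchange_big; apply: eq_bigr => j _ /=.
rewrite mxE mulr_sumr; apply: eq_bigr => i _.
by rewrite !mxE -mulrA (mulrC (A j i)).
Qed.

Lemma edotvv_ge0 u : 0 <= edot u u.
Proof. by apply: sumr_ge0 => i _; rewrite -expr2 sqr_ge0. Qed.

Lemma enorm_ge0 u : 0 <= enorm u.
Proof. exact: sqrtr_ge0. Qed.

Lemma enorm_sqr u : enorm u ^+ 2 = edot u u.
Proof. by rewrite sqr_sqrtr ?edotvv_ge0. Qed.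

Lemma enormZ a u : enorm (a *: u) = `|a| * enorm u.
Proof.
rewrite /enorm edotZl edotZr mulrA -expr2 sqrtrM ?sqr_ge0//.
by rewrite sqrtr_sqr.
Qed.

Lemma enormN u : enorm (- u) = enorm u.
Proof. by rewrite -scaleN1r enormZ normrN1 mul1r. Qed.

Lemma enormB u v : enorm (u - v) = enorm (v - u).
Proof. by rewrite -enormN opprB. Qed.

Lemma norm_coord_le u i : `|u 0 i| <= `|u|.
Proof.
rewrite [leRHS]/Num.Def.normr/= mx_normrE.
exact: (le_bigmax _ (fun ij => `|u ij.1 ij.2|) (0, i)).
Qed.

(** The squared norm dominates the square of each coordinate. This turns remainder estimates in the
    sup norm into Euclidean ones. *)
Lemma norm_le_enorm u : `|u| <= enorm u.
Proof.
rewrite [leLHS]/Num.Def.normr/= mx_normrE.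
apply: bigmax_le => [|[i j] _]; first exact: enorm_ge0.
rewrite ord1 /= -sqrtr_sqr ler_sqrt ?edotvv_ge0// /edot (bigD1 j)//= expr2.
by rewrite lerDl; apply: sumr_ge0 => k _; rewrite -expr2 sqr_ge0.
Qed.

(** A crude Cauchy-Schwarz inequality: each of the [n] products is at most the product of the sup
    norms. *)
Lemma norm_edot_le u v : `|edot u v| <= n%:R * `|u| * `|v|.
Proof.
apply: le_trans (ler_norm_sum _ _ _) _.
rewrite -mulrA mulr_natl -[X in _ *+ X]card_ord -sumr_const.
by apply: ler_sum => i _; rewrite normrM ler_pM ?norm_coord_le.
Qed.

Lemma enorm0 : enorm (0 : 'rV[R]_n) = 0.
Proof. by have := enormZ 0 (0 : 'rV[R]_n); rewrite scale0r normr0 mul0r. Qed.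

Lemma enorm_gt0 u : (0 < enorm u) = (u != 0).
Proof.
have [->|u0] := eqVneq u 0; first by rewrite enorm0 ltxx.
by rewrite (lt_le_trans _ (norm_le_enorm u))// normr_gt0.
Qed.

Lemma enorm_near0 (c : 'rV[R]_n) e : 0 < e ->
  \forall y \near c, enorm (y - c) < e.
Proof.
(* The comparison constant is [n + 1] rather than the square root of [n], so that the division is
   legitimate even for [n = 0]. *)
move=> e0; have k0 : 0 < n%:R + 1 :> R by rewrite ltr_wpDl.
have d0 : 0 < e / (n%:R + 1) by rewrite divr_gt0.
near=> y.
have yc : `|y - c| < e / (n%:R + 1).
  near: y; apply/nbhs_ballP; exists (e / (n%:R + 1)) => //= y.
  by rewrite -ball_normE /= distrC.
have h : enorm (y - c) <= (n%:R + 1) * `|y - c|.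
  rewrite -(@ger0_norm _ (_ * _)) ?mulr_ge0// -sqrtr_sqr ler_sqrt ?sqr_ge0//.
  apply: le_trans (ler_norm _) _.
  apply: le_trans (norm_edot_le _ _) _.
  rewrite exprMn expr2 -mulrA -expr2; apply: ler_wpM2r; first exact: sqr_ge0.
  by rewrite -expr2 sqrrD1; have := ler0n R n; nra.
by apply: le_lt_trans h _; rewrite mulrC -ltr_pdivlMr.
Unshelve. all: by end_near. Qed.

End EuclideanFacts.

(** * Gradients and the differential of an inner product *)

Section Gradient.
Context {R : realType} {n : nat}.
Implicit Types (f t : 'rV[R]_n -> R) (x v h : 'rV[R]_n).

(** Fréchet differentiability at [x] with gradient [v], in an epsilon form with the Euclidean norm
    that can be combined directly with [frechet_subdiffP]. *)
Definition has_grad f x v : Prop := forall e, 0 < e ->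
  \forall y \near x, `|f y - f x - edot v (y - x)| <= e * enorm (y - x).

Lemma diff_near {V W : normedModType R} (f : V -> W) (x : V) :
  differentiable f x -> forall e, 0 < e ->
  \forall y \near x, `|f y - f x - 'd f x (y - x)| <= e * `|y - x|.
Proof.
move=> [[_ dfE]] e e0; move: dfE => /eqaddoP /(_ e e0).
rewrite lim_id//; apply: filterS => y.
by rewrite !fctE opprD addrA.
Qed.

(** Expand [h] in the canonical basis; the coefficients of the differential are the partial
    derivatives collected in [grad]. *)
Lemma diff_grad f x h : differentiable f x -> 'd f x h = edot (grad f x) h.
Proof.
move=> df; rewrite [in LHS](row_sum_delta h) linear_sum.
by apply: eq_bigr => i _; rewrite linearZ /= mxE deriveE// mulrC.
Qed.

Lemma differentiable_has_grad f x v :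
  differentiable f x -> (forall h, 'd f x h = edot v h) -> has_grad f x v.
Proof.
move=> df dv e e0; apply: filterS (diff_near df e0) => y.
rewrite dv => /le_trans; apply.
by apply: ler_wpM2l; [exact: ltW | exact: norm_le_enorm].
Qed.

Lemma has_gradD f t x u v :
  has_grad f x u -> has_grad t x v -> has_grad (fun y => f y + t y) x (u + v).
Proof.
move=> hf ht e e0; have e2 : 0 < e / 2 by rewrite divr_gt0.
near=> y.
have h1 : `|f y - f x - edot u (y - x)| <= e / 2 * enorm (y - x).
  by near: y; exact: hf.
have h2 : `|t y - t x - edot v (y - x)| <= e / 2 * enorm (y - x).
  by near: y; exact: ht.
rewrite edotDl [e]splitr mulrDl.
apply: le_trans (lerD h1 h2); apply: le_trans (ler_normD _ _).
rewrite (_ : _ + _ - _ - _ =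
  f y - f x - edot u (y - x) + (t y - t x - edot v (y - x)))//.
by ring.
Unshelve. all: by end_near. Qed.

Lemma has_grad_affine x v c b : has_grad (fun y => b + edot v (y - c)) x v.
Proof.
move=> e e0; near=> y.
rewrite (_ : _ - _ = 0) ?normr0 ?mulr_ge0 ?enorm_ge0 ?ltW//.
by rewrite !edotBr; ring.
Unshelve. all: by end_near. Qed.

Lemma differentiable_entry {m k : nat} {V : normedModType R}
  (a : V -> 'M[R]_(m, k)) (x : V) i j :
  differentiable a x -> differentiable (fun z => a z i j : R) x.
Proof.
by move=> da; exact: differentiable_comp da (differentiable_coord _ i j).
Qed.

Lemma diff_entry {m k : nat} {V : normedModType R} (a : V -> 'M[R]_(m, k))
  (x : V) (h : V) i j :
  differentiable a x -> 'd (fun z => a z i j) x h = 'd a x h i j.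
Proof.
move=> da.
rewrite -!deriveE//; last exact: differentiable_entry.
by rewrite derive_mx ?mxE//; exact: diff_derivable.
Qed.

Lemma differentiable_edot {m : nat} (a b : 'rV[R]_n -> 'rV[R]_m) x :
  differentiable a x -> differentiable b x ->
  differentiable (fun z => edot (a z) (b z)) x.
Proof.
move=> da db.
rewrite (_ : (fun _ => _) = \sum_i (fun z => a z 0 i * b z 0 i)); last first.
  by apply/funext => z; rewrite fct_sumE.
by apply: differentiable_sum => i; apply: differentiableM;
  exact: differentiable_entry.
Qed.

(** The Leibniz rule for each product of coordinates, summed up. *)
Lemma diff_edot {m : nat} (a b : 'rV[R]_n -> 'rV[R]_m) x h :
  differentiable a x -> differentiable b x ->
  'd (fun z => edot (a z) (b z)) x h
    = edot ('d a x h) (b x) + edot (a x) ('d b x h).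
Proof.
move=> da db.
have dai i : differentiable (fun z => a z 0 i) x.
  exact: differentiable_entry.
have dbi i : differentiable (fun z => b z 0 i) x.
  exact: differentiable_entry.
rewrite -deriveE; last exact: differentiable_edot.
rewrite (_ : (fun _ => _) = \sum_i (fun z => a z 0 i * b z 0 i)); last first.
  by apply/funext => z; rewrite fct_sumE.
rewrite derive_sum => [|i]; last first.
  by apply: diff_derivable; exact: differentiableM.
rewrite -big_split /=; apply: eq_bigr => i _.
rewrite (@deriveM _ _ (fun z => a z 0 i) (fun z => b z 0 i)); last 2 first.
- exact: diff_derivable.
- exact: diff_derivable.
have -> : 'D_h (fun z => a z 0 i) x = 'd a x h 0 i.
  by rewrite deriveE ?diff_entry.
have -> : 'D_h (fun z => b z 0 i) x = 'd b x h 0 i.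
  by rewrite deriveE ?diff_entry.
by rewrite addrC; congr (_ + _); exact: mulrC.
Qed.

End Gradient.

(** * Symmetry of the Hessian *)

Section HessianSymmetry.
Context {R : realType} {n : nat}.
Variables (f : 'rV[R]_n -> R) (x : 'rV[R]_n).
Hypotheses (f_diff : forall y, differentiable f y)
  (gradf_diff : differentiable (grad f) x).

Lemma is_derive_line c u (s : R) :
  is_derive s 1 (fun s => f (c + s *: u)) (edot (grad f (c + s *: u)) u).
Proof.
have dl : is_diff s (fun s : R => c + s *: u) ( *:%R ^~ u).
  have := is_diffD (is_diff_cst c s) (is_diff_scalel s u).
  by rewrite add0r.
have dfl : differentiable (f \o (fun s : R => c + s *: u)) s.
  by apply: differentiable_comp.
split; first exact/derivable1_diffP.
rewrite -diff_grad// deriveE// diff_comp//=.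
by rewrite diff_val scale1r.
Qed.

Lemma diff_grad_hess h : 'd (grad f) x h = h *m hess f x.
Proof. by rewrite -deriveE// deriveEjacobian. Qed.

(* By the mean value theorem the second difference is [t] times the increment
   of [<grad f, u>] along [t v], taken at [x + s u] for some [0 < s < t]. *)
Lemma second_difference_near u v e : 0 < e -> \forall t \near 0^'+,
  `|f (x + t *: u + t *: v) - f (x + t *: u) - f (x + t *: v) + f x
    - t ^+ 2 * edot (v *m hess f x) u| <= e * t ^+ 2.
Proof.
(* The final estimate yields the factor [K - 1]; adding 1 keeps [K] positive when [u = 0] or
   [n = 0]. *)
move=> e0; pose K := n%:R * (2 * `|u| + `|v|) * `|u| + 1.
have K0 : 0 < K by rewrite ltr_wpDl// !mulr_ge0 ?addr_ge0 ?mulr_ge0.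
have d0 : 0 < e / K by rewrite divr_gt0.
have /nbhs_ballP[r /= r0 rP] := diff_near gradf_diff d0.
have rP' k : `|k| < r ->
    `|grad f (x + k) - grad f x - k *m hess f x| <= e / K * `|k|.
  move=> kr; have := rP (x + k).
  rewrite -ball_normE /= opprD addrA subrr sub0r normrN => /(_ kr).
  by rewrite [x + k - x]addrC addKr diff_grad_hess.
(* The bound [t * L < r] for this sum [L] places all increments used below inside the ball of radius
   [r]; the summand 1 makes the divisor positive. *)
have L0 : 0 < `|u| + `|v| + 1 by rewrite ltr_wpDl ?addr_ge0.
near=> t.
have t0 : 0 < t by [].
have tr : t * (`|u| + `|v| + 1) < r.
  rewrite -ltr_pdivlMr//; near: t; apply: nbhs_right_lt.
  by rewrite divr_gt0.
(* The second difference is [F t - F 0]. *)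
pose F s := f (x + s *: u + t *: v) - f (x + s *: u).
pose dF s := edot (grad f (x + s *: u + t *: v) - grad f (x + s *: u)) u.
have dFP (s : R) : is_derive s 1 F (dF s).
  rewrite /dF edotBl; apply: is_deriveB; last exact: is_derive_line.
  rewrite (_ : (fun _ => _) = fun s => f (x + t *: v + s *: u)).
    by rewrite addrAC; exact: is_derive_line.
  by apply/funext => k; rewrite addrAC.
have [s /[!in_itv]/= /andP[s0 st] Fs] : exists2 s, s \in `]0, t[%R &
    F t - F 0 = dF s * (t - 0).
  apply: MVT => //.
  by apply: derivable_within_continuous => k _; exact: ex_derive.
have -> : f (x + t *: u + t *: v) - f (x + t *: u) - f (x + t *: v) + f x
    = dF s * t.
  by rewrite -[t in RHS]subr0 -Fs /F !scale0r !addr0; ring.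
have k1 : `|s *: u + t *: v| <= t * (`|u| + `|v|).
  rewrite (le_trans (ler_normD _ _))// !normrZ !gtr0_norm// mulrDr lerD2r.
  by rewrite ler_wpM2r// ltW.
have k2 : `|s *: u| <= t * `|u|.
  by rewrite normrZ gtr0_norm// ler_wpM2r// ltW.
have tu : 0 <= t * `|u| by rewrite mulr_ge0 ?(ltW t0).
have tv : 0 <= t * `|v| by rewrite mulr_ge0 ?(ltW t0).
have h1 := rP' (s *: u + t *: v).
have h2 := rP' (s *: u).
have {h1} h1 : `|grad f (x + (s *: u + t *: v)) - grad f x
    - (s *: u + t *: v) *m hess f x| <= e / K * (t * (`|u| + `|v|)).
  apply: le_trans (h1 _) _; last by rewrite ler_wpM2l// ltW.
  by apply: le_lt_trans k1 _; apply: le_lt_trans tr; lra.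
have {h2} h2 : `|grad f (x + s *: u) - grad f x - (s *: u) *m hess f x|
    <= e / K * (t * `|u|).
  apply: le_trans (h2 _) _; last by rewrite ler_wpM2l// ltW.
  by apply: le_lt_trans k2 _; apply: le_lt_trans tr; lra.
(* [A] and [B] are the first-order remainders of [grad f] at the two points. In [A - B] the value
   [grad f x] and the contribution of [s *: u] cancel, leaving the gradient increment minus
   [t *: (v *m hess f x)]. *)
set A := (X in `|X| <= _) in h1; set B := (X in `|X| <= _) in h2.
have -> : dF s * t - t ^+ 2 * edot (v *m hess f x) u = t * edot (A - B) u.
  rewrite (_ : A - B = grad f (x + s *: u + t *: v) - grad f (x + s *: u)
      - t *: (v *m hess f x)).
    by rewrite [in RHS]edotBl edotZl /dF; ring.
  rewrite /A /B (addrA x) mulmxDl -!scalemxAl.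
  move: (grad f _) (grad f _) (grad f _) (_ *m _) (_ *m _) => a b c d k.
  by apply/rowP => i; rewrite !mxE; ring.
rewrite normrM (gtr0_norm t0).
have h3 : `|A - B| <= e / K * (t * (2 * `|u| + `|v|)).
  apply: le_trans (ler_normB _ _) _; apply: le_trans (lerD h1 h2) _.
  by rewrite -!mulrDr le_eqVlt -subr_eq0; apply/orP; left; apply/eqP; ring.
have h4 : `|edot (A - B) u| <= n%:R * (e / K * (t * (2 * `|u| + `|v|))) * `|u|.
  by apply: le_trans (norm_edot_le _ _) _; rewrite ler_wpM2r// ler_wpM2l.
rewrite expr2 mulrCA; apply: ler_wpM2l; first exact: ltW.
apply: le_trans h4 _.
rewrite [leLHS](_ : _ = e / K * t * (K - 1)); last first.
  by rewrite [K - 1]addrK; ring.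
rewrite -[X in _ <= X * t](divfK (lt0r_neq0 K0)) (mulrAC _ K).
by apply: ler_wpM2l; [rewrite mulr_ge0 ?(ltW d0) ?(ltW t0)|rewrite gerBl].
Unshelve. all: by end_near. Qed.

(** The second difference is symmetric in [u] and [v], and after division by [t ^+ 2] it
    approximates both values of the bilinear form within [e / 2]. Hence these differ by at most [e],
    for every [e > 0]. *)
Lemma hess_sym : (hess f x)^T = hess f x.
Proof.
(* Testing the bilinear form on basis vectors recovers the entries. *)
suff H u v : edot (v *m hess f x) u = edot (u *m hess f x) v.
  apply/matrixP => i j; rewrite mxE.
  have := H (delta_mx 0 i) (delta_mx 0 j).
  have E k l : edot (delta_mx 0 k *m hess f x) (delta_mx 0 l) = hess f x k l.
    rewrite -rowE /edot (bigD1 l)//= big1 ?addr0 => [|m ml]; rewrite !mxE.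
      by rewrite !eqxx mulr1.
    by rewrite (negbTE ml) andbF mulr0.
  by rewrite !E.
apply/eqP; rewrite -subr_eq0 -normr_le0; apply/ler_addgt0Pl => e e0.
rewrite addr0.
have e2 : 0 < e / 2 by rewrite divr_gt0.
have [t [t0 [h1 h2]]] := filter_ex (filterI (nbhs_right_gt (0 : R))
  (filterI (second_difference_near u v e2) (second_difference_near v u e2))).
rewrite -(ler_pM2l (exprn_gt0 2 t0)) -[X in X * `|_|]gtr0_norm ?exprn_gt0//.
rewrite -normrM; move: h1 h2.
rewrite (addrAC x (t *: v)) => h1 h2.
set X := (X in `|X| <= _) in h1; set Y := (X in `|X| <= _) in h2.
have -> : t ^+ 2 * (edot (v *m hess f x) u - edot (u *m hess f x) v) = Y - X.
  by rewrite /X /Y; ring.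
by apply: le_trans (ler_normB _ _) _; apply: le_trans (lerD h2 h1) _; lra.
Qed.

End HessianSymmetry.

(** * Calculus of Fréchet subgradients *)

Section FrechetSubdifferential.
Context {R : realType} {n : nat}.
Implicit Types (psi : 'rV[R]_n -> \bar R) (x z v : 'rV[R]_n).

(** Multiplying the difference quotient by [enorm (y - x)] clears the denominator. An infinite
    [psi y] is harmless: the value [+oo] satisfies both forms, [-oo] violates both. *)
Lemma frechet_subdiffP psi x z : frechet_subdiff psi x z <->
  psi x \is a fin_num /\ forall e, 0 < e -> \forall y \near x,
    (psi x + (edot z (y - x) - e * enorm (y - x))%:E <= psi y)%E.
Proof.
rewrite /frechet_subdiff /= limf_einfE.
split=> -[xfin H]; split=> //.
  move=> e e0.
  have : ((- e)%:E < 0)%E by rewrite lte_fin oppr_lt0.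
  (* The lower limit is a supremum of infima over punctured neighborhoods, so the infimum over some
     [V] exceeds [- e]. *)
  move=> /lt_le_trans /(_ H) /ereal_sup_gt[_ [V /= + <-] eV].
move=> Vx.
  have {}Vx : \forall y \near x, y != x -> V y by exact: Vx.
  apply: filterS Vx => y Vy.
  (* The quotient gives no information at [y = x], where the bound is an equality. *)
  have [->|yx] := eqVneq y x.
    by rewrite subrr edot0r enorm0 mulr0 subrr adde0.
  have yx0 : 0 < enorm (y - x) by rewrite enorm_gt0 subr_eq0.
  have {eV} := lt_le_trans eV (ereal_inf_lbound (imageP _ (Vy yx))).
  rewrite /=; case: (psi y) => [r| |].
  - rewrite -(fineK xfin) -!EFinB -EFinM -EFinD lte_fin lee_fin.
    by rewrite ltr_pdivlMr// => h; lra.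
  - by rewrite leey.
  - rewrite -(fineK xfin) /= mulNyr gtr0_sg ?invr_gt0// mul1e.
    by rewrite ltNge leNye.
apply/lee_addgt0Pr => e e0; rewrite -leeBlDr// sub0e.
apply: le_ereal_sup_tmp.
pose V := [set y | y != x /\
  (psi x + (edot z (y - x) - e * enorm (y - x))%:E <= psi y)%E].
have Vx : nbhs x^' V.
  have H' : \forall y \near x, y != x -> V y.
    by apply: filterS (H e e0) => y hy yx.
  exact: H'.
eexists; first by exists V; first exact: Vx.
apply: le_ereal_inf_tmp => _ [y [yx hy] <-].
have yx0 : 0 < enorm (y - x) by rewrite enorm_gt0 subr_eq0.
move: hy; case: (psi y) => [r| |] /=.
- rewrite -(fineK xfin) -!EFinB -EFinM -EFinD !lee_fin.
  by rewrite ler_pdivlMr// => h; lra.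
- by move=> _; rewrite -(fineK xfin) mulyr gtr0_sg ?invr_gt0// mul1e leey.
- by rewrite -(fineK xfin) -EFinD leNgt ltNyr.
Qed.

(** Subtracting the expansion of the majorant [t] from the subgradient inequality bounds
    [edot (z - v) (y - x)] by a small multiple of [enorm (y - x)]; moving in the direction [z - v]
    forces [z = v]. *)
Lemma frechet_subdiff_grad psi (t : 'rV[R]_n -> R) x z v :
  (forall y, (psi y <= (t y)%:E)%E) -> psi x = (t x)%:E -> has_grad t x v ->
  frechet_subdiff psi x z -> z = v.
Proof.
move=> le_t eq_t gt /frechet_subdiffP[_ hz]; apply/eqP.
apply: contraT => zv; pose d := z - v.
have d0 : 0 < enorm d by rewrite enorm_gt0 subr_eq0.
(* The two errors add up to [2 * e], half of [enorm d], whereas the inequality along [d] would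
   require [enorm d <= 2 * e]. *)
pose e := enorm d / 4; have e0 : 0 < e by rewrite divr_gt0.
have [r /= r0 rP] := (nbhs_ballP _ _).1 (filterI (hz e e0) (gt e e0)).
(* With this [s] the step [s *: d] has sup norm [r / 2]. *)
pose s := r / 2 / `|d|.
have dn0 : 0 < `|d| by rewrite normr_gt0 -enorm_gt0.
have s0 : 0 < s by rewrite !divr_gt0.
have /rP[] : ball x r (x + s *: d).
  rewrite -ball_normE /= opprD addrA subrr sub0r normrN normrZ gtr0_norm//.
  by rewrite /s divfK ?gt_eqF// ltr_pdivrMr// ltr_pMr// ltr1n.
rewrite [x + s *: d - x]addrC addKr eq_t enormZ !edotZr (gtr0_norm s0).
move=> /le_trans /(_ (le_t _)); rewrite -EFinD lee_fin => h1.
move=> /ler_normlP[_ h2].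
have h3 : s * (edot z d - edot v d) <= s * (2 * e * enorm d).
  by rewrite mulrBr; lra.
move: h3; rewrite ler_pM2l// -edotBl -/d -enorm_sqr expr2 ler_pM2r// /e.
by lra.
Qed.

(** Fermat's rule: minimality bounds the increment of [psi] below by the decrease of [t], whose
    first-order expansion has slope [- v]. *)
Lemma frechet_subdiff_min psi (t : 'rV[R]_n -> R) x v :
  psi x \is a fin_num -> (forall y, (psi x + (t x)%:E <= psi y + (t y)%:E)%E) ->
  has_grad t x v -> frechet_subdiff psi x (- v).
Proof.
move=> xfin xmin gt; apply/frechet_subdiffP; split=> // e e0.
apply: filterS (gt e e0) => y /ler_normlP[_ h].
have := xmin y; rewrite -(fineK xfin); case: (psi y) => [r| |].
- by rewrite -!EFinD !lee_fin edotNl => h'; lra.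
- by move=> _; rewrite leey.
- by rewrite addNye leNgt ltNyr.
Qed.

(** Constant sequences suffice. *)
Lemma frechet_subdiff_limiting psi x z :
  frechet_subdiff psi x z -> limiting_subdiff psi x z.
Proof.
move=> hz; split; first by case: hz.
by exists (fun=> x), (fun=> z); split=> //; exact: cvg_cst.
Qed.

End FrechetSubdifferential.

(** * Gradient of the power proximal term *)

Section ProxGradient.
Context {R : realType} {n : nat} (p gamma : R).
Hypotheses (p_gt1 : 1 < p) (gamma_gt0 : 0 < gamma).
Implicit Types x c : 'rV[R]_n.

Lemma ho_prox_termC x c : ho_prox_term p gamma x c = ho_prox_term p gamma c x.
Proof. by rewrite /ho_prox_term enormB. Qed.

Lemma ho_prox_termxx x : ho_prox_term p gamma x x = 0.
Proof.
rewrite /ho_prox_term subrr enorm0 powR0 ?mulr0//.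
by rewrite gt_eqF// (lt_trans ltr01).
Qed.

(** As [p > 1], splitting one factor off the [p]-th power of the norm leaves the exponent
    [p - 1 > 0], so the term is of smaller order than [enorm (y - c)]. *)
Lemma ho_prox_term_has_grad_center c :
  has_grad (fun y => ho_prox_term p gamma y c) c 0.
Proof.
have p0 : 0 < p := lt_trans ltr01 p_gt1.
have p1 : 0 < p - 1 by rewrite subr_gt0.
(* This [d] solves [d ^ (p - 1) = e * (p * gamma)]. *)
move=> e e0; pose d := (e * (p * gamma)) `^ (p - 1)^-1.
have d0 : 0 < d by rewrite powR_gt0 ?mulr_gt0.
apply: filterS (enorm_near0 c d0) => y yd.
rewrite ho_prox_termxx subr0 edotC edot0r subr0 ger0_norm; last first.
  by rewrite mulr_ge0 ?powR_ge0 ?invr_ge0 ?mulr_ge0 ?ltW.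
rewrite /ho_prox_term ler_pdivrMl ?mulr_gt0//.
rewrite -(mulr_powRB1 (enorm_ge0 _) p0) mulrC mulrA.
apply: ler_wpM2r; first exact: enorm_ge0.
apply: (@le_trans _ _ (d `^ (p - 1))).
  by apply: ge0_ler_powR; rewrite ?nnegrE ?enorm_ge0 ?ltW.
rewrite /d -powRrM mulVf ?(gt_eqF p1)// powRr1 1?mulrC//.
by rewrite !mulr_ge0 ?(ltW e0) ?(ltW p0) ?(ltW gamma_gt0).
Qed.

(** Away from [c], the chain rule applies to the power [p / 2] of the squared distance, which is
    positive there. *)
Lemma ho_prox_term_has_grad c x : has_grad (fun y => ho_prox_term p gamma y c)
  x ((gamma^-1 * enorm (x - c) `^ (p - 2)) *: (x - c)).
Proof.
have p0 : 0 < p := lt_trans ltr01 p_gt1.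
have [->|xc] := eqVneq x c.
  (* Whatever the value of the power of 0, it scales the zero vector, in accordance with the
     convention at 0. *)
  by rewrite subrr scaler0; exact: ho_prox_term_has_grad_center.
have xc0 : 0 < enorm (x - c) by rewrite enorm_gt0 subr_eq0.
pose q (y : 'rV[R]_n) := edot (y - c) (y - c).
pose phi (s : R) := (p * gamma)^-1 * s `^ (p / 2).
have sqrE y : enorm y `^ 2 = edot y y.
  by rewrite (powR_mulrn 2) ?enorm_ge0// enorm_sqr.
have qx0 : 0 < q x by rewrite /q -enorm_sqr exprn_gt0.
have -> : (fun y => ho_prox_term p gamma y c) = phi \o q.
  apply/funext => y; rewrite /phi /q /ho_prox_term /= -sqrE -powRrM.
  by congr (_ * _ `^ _); field.
have dB : is_diff x (fun y => y - c) id.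
  by have := is_diffB (is_diff_id x) (is_diff_cst c x); rewrite subr0.
have dq : differentiable q x by exact: differentiable_edot.
have dphi :
    is_derive (q x) 1 phi ((p * gamma)^-1 * (p / 2 * q x `^ (p / 2 - 1))).
  have dpow := is_derive1_powR (p / 2) qx0.
  exact: is_deriveZ dpow.
apply: differentiable_has_grad => [|h].
  by apply: differentiable_comp => //; apply/derivable1_diffP; exact: ex_derive.
rewrite diff_comp//; last by apply/derivable1_diffP; exact: ex_derive.
rewrite /= deriv1E; last exact: ex_derive.
rewrite derive1E derive_val /q diff_edot// diff_val.
rewrite -/(q x) edotZl /q -sqrE -powRrM.
rewrite (_ : 2 * (p / 2 - 1) = p - 2); last by field.
rewrite (edotC h) /GRing.scale /=; field.
by rewrite !gt_eqF.
Qed.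

End ProxGradient.

(** * Majorant of the envelope and Fermat's rule at the minimizer *)

Theorem lemma25 (R : realType) (n : nat) (p : R) (hp : 1 < p)
  (g : 'rV[R]_n -> \bar R) (g_gtNy : forall x, (-oo < g x)%E)
  (g_proper : proper_fun g) (g_lsc : lower_semicontinuous g)
  (g_pb : ho_prox_bounded p g) (g_thr : (0 < ho_prox_threshold p g)%E)
  (f : 'rV[R]_n -> R) (f_diff : forall x, differentiable f x)
  (xbar : 'rV[R]_n) (phi_fin : ((f xbar)%:E + g xbar < +oo)%E)
  (U : set 'rV[R]_n) (U_open : open U) (U_xbar : U xbar) (f_C2 : C2_on U f) :
  forall gamma : R, 0 < gamma -> (gamma%:E < ho_prox_threshold p g)%E ->
  forall ybar : 'rV[R]_n, hofb_splitting p gamma f g xbar ybar ->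
    [set zeta - (ybar - xbar) *m hess f xbar
       | zeta in frechet_subdiff (hofb_envelope p gamma f g) xbar]
    `<=` [set grad f xbar + v | v in limiting_subdiff g ybar]
         `&` [set (gamma^-1 * enorm (xbar - ybar) `^ (p - 2))
                    *: (xbar - ybar)].
Proof.
move=> gamma gamma0 _ ybar ymin _ [zeta hzeta <-].
have [_ dG _] := f_C2 xbar U_xbar.
pose w := (gamma^-1 * enorm (xbar - ybar) `^ (p - 2)) *: (xbar - ybar).
(* If [g ybar] were [+oo], so would be the minimal value of the objective, which is at most its
   value [f xbar + g xbar] at [xbar]. *)
have gy_fin : g ybar \is a fin_num.
  rewrite fin_numElt g_gtNy /= ltNge leye_eq; apply/eqP => gy.
  have := ymin xbar; rewrite /hofb_objective gy addey// addye//.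
  rewrite subrr edot0r addr0 ho_prox_termxx// adde0.
  by rewrite leye_eq => /eqP E; rewrite E in phi_fin.
have objE x : hofb_objective p gamma f g x ybar =
    (f x + edot (grad f x) (ybar - x) + fine (g ybar)
       + ho_prox_term p gamma x ybar)%:E.
  by rewrite /hofb_objective -[in LHS](fineK gy_fin) -!EFinD.
set theta := fun x => f x + edot (grad f x) (ybar - x) + fine (g ybar)
       + ho_prox_term p gamma x ybar in objE.
have dB : is_diff xbar (fun y => ybar - y) -%R.
  by have := is_diffB (is_diff_cst ybar xbar) (is_diff_id xbar); rewrite sub0r.
have theta_grad : has_grad theta xbar ((ybar - xbar) *m hess f xbar + w).
  have h1 : has_grad f xbar (grad f xbar).
    by apply: differentiable_has_grad => // h; exact: diff_grad.
  have h2 : has_grad (fun x => edot (grad f x) (ybar - x)) xbar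
      ((ybar - xbar) *m hess f xbar - grad f xbar).
    apply: differentiable_has_grad => [|h]; first exact: differentiable_edot.
    have dBE : 'd (fun y => ybar - y) xbar h = - h by rewrite diff_val.
    apply: etrans (diff_edot h dG ex_diff) _.
    apply: etrans (congr2
      (fun u v => edot u (ybar - xbar) + edot (grad f xbar) v)
      (diff_grad_hess dG h) dBE) _.
    (* Moving the Hessian to the other factor transposes it; symmetry removes the transpose. *)
    rewrite edot_mulmx (hess_sym f_diff dG).
    by rewrite edotNr edotBl edotC.
  have h3 := ho_prox_term_has_grad hp gamma0 ybar xbar.
  (* The constant [fine (g ybar)] enters as an affine function of slope 0. The gradient of [f] then
     cancels against the term [- grad f xbar] of [h2]. *)
  have := has_gradD (has_gradD (has_gradD h1 h2)
    (has_grad_affine xbar 0 xbar (fine (g ybar)))) h3.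
  rewrite addr0 addrCA subrr addr0.
  congr has_grad; apply/funext => x; rewrite /theta.
  by rewrite [edot 0 _]edotC edot0r addr0.
have zetaE : zeta = (ybar - xbar) *m hess f xbar + w.
  apply: frechet_subdiff_grad theta_grad hzeta => [x|].
    by rewrite -objE; apply: ereal_inf_lbound; exists ybar.
  apply/eqP; rewrite eq_le -objE; apply/andP; split.
    by apply: ereal_inf_lbound; exists ybar.
  by apply: le_ereal_inf_tmp => _ [y _ <-]; exact: ymin.
rewrite zetaE addrAC subrr add0r; split=> //.
exists (w - grad f xbar); last by rewrite addrC subrK.
apply: frechet_subdiff_limiting; rewrite -opprB.
(* The objective at [xbar] is [g] plus the smooth function [l] plus the proximal term, and the
   smooth part has gradient [grad f xbar - w] at [ybar]. *)
pose l y := f xbar + edot (grad f xbar) (y - xbar).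
have tmin y : (g ybar + (l ybar + ho_prox_term p gamma xbar ybar)%:E
    <= g y + (l y + ho_prox_term p gamma xbar y)%:E)%E.
  have objE' z : hofb_objective p gamma f g xbar z =
      (g z + (l z + ho_prox_term p gamma xbar z)%:E)%E.
    by rewrite /hofb_objective addeAC addeC -EFinD.
  by rewrite -!objE'; exact: ymin.
have wE : grad f xbar - w = grad f xbar +
    (gamma^-1 * enorm (ybar - xbar) `^ (p - 2)) *: (ybar - xbar).
  by rewrite /w -scalerN opprB enormB.
apply: frechet_subdiff_min gy_fin tmin _; rewrite wE.
under [X in has_grad X]eq_fun do rewrite ho_prox_termC.
apply: has_gradD; first exact: has_grad_affine.
exact: ho_prox_term_has_grad.
Qed.
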